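(* Let $C$ be a multi-rotationally symmetric planar convex body, with minimal degree $\chi_C\geq 3$, and let $R$ be its circumradius. Let $k_C$ be the maximal degree of $C$, let $\{k_1=\chi_C,\ldots,k_n=k_C\}$ with $k_1<\ldots<k_n$ be the set of divisors of $k_C$ greater than $1$, and let $P_{k_i}$ be the standard $k_i$-partition associated to $C$, $i=1,\ldots,n$. Then the chain of inequalities $d_M(P_{k_1})\geq\ldots\geq d_M(P_{k_n})$ is a chain of equalities (that is, $d_M(P_{k_1})=\ldots=d_M(P_{k_n})$) if and only if $d_M(P_{\chi_C})=R$.
   Context: A planar convex body is a compact convex subset of $\mathbb{R}^2$ with non-empty interior. Its circumradius is the radius of the smallest disk containing it. For $k\in\mathbb{N}$, $k\geq 2$, a planar convex body $C$ is $k$-rotationally symmetric if there is a point $p\in C$ (the center of symmetry of $C$) such that $C$ is invariant under the rotation of angle $2\pi/k$ about $p$. $C$ is multi-rotationally symmetric if it is $k$-rotationally symmetric for more than one value of $k$. The minimal degree $\chi_C$ is the smallest $k\geq 2$ for which $C$ is $k$-rotationally symmetric; if $C$ is not a circle (i.e. a disk), the maximal degree $k_C$ is the largest such $k$. (A circle has minimal degree $2$.) $C$ is $k$-rotationally symmetric exactly when $k$ is a divisor of $k_C$ greater than $1$. Standard $k$-partition: let $C$ be $k$-rotationally symmetric with center of symmetry $p$. Let $x_1,\ldots,x_k$ be points of $\partial C$ at minimal distance to $p$, symmetrically placed along $\partial C$ (they are the images of one such point under the rotations about $p$ of angles that are multiples of $2\pi/k$). The line segments $\overline{p\,x_i}$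 divide $C$ into $k$ connected congruent (closed) subsets $C_1,\ldots,C_k$; this decomposition is the standard $k$-partition $P_k$ associated to $C$. The maximum relative diameter of a decomposition $P$ of $C$ into subsets $C_1,\ldots,C_k$ is $d_M(P)=\max\{D(C_i): i=1,\ldots,k\}$, where $D(C_i)=\max\{d(x,y):x,y\in C_i\}$ is the Euclidean diameter. *)

(* Defs.v *)
From HB Require Import structures.
From mathcomp Require Import all_boot all_order all_algebra.
From mathcomp Require Import all_classical all_reals all_analysis.

Set Implicit Arguments.
Unset Strict Implicit.
Unset Printing Implicit Defensive.

Import Order.TTheory GRing.Theory Num.Theory.
Import numFieldNormedType.Exports.

Local Open Scope classical_set_scope.
Local Open Scope ring_scope.

(* The library's norm on row vectors is the sup norm. It induces the usual
   topology of the plane, so compactness, interiors, closures and connected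
   components below are the library's; all lengths are measured with the
   Euclidean distance [eucl_dist]. *)
Notation plane R := 'rV[R]_2.

Section Plane.
Variable R : realType.
Implicit Types (A C : set (plane R)) (P : set (set (plane R))).
Implicit Types (p x y v : plane R) (k : nat).

Definition eucl_dist x y : R := Num.sqrt (\sum_(i < 2) (x 0 i - y 0 i) ^+ 2).

Definition disk p (r : R) : set (plane R) := [set y | eucl_dist p y <= r].

Definition segment x y : set (plane R) :=
  [set (1 - t) *: x + t *: y | t in `[0, 1]].

Definition rotation (t : R) p v : plane R :=
  p + \row_(j < 2) (if j == 0
                    then cos t * (v - p) 0 0 - sin t * (v - p) 0 1
                    else sin t * (v - p) 0 0 + cos t * (v - p) 0 1).

Definition frontier A : set (plane R) := closure A `\` A°.

Definition convex_body C := [/\ compact C, convex_set C & C° !=set0].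

Definition circumradius C : R :=
  inf [set r | 0 <= r /\ exists c, C `<=` disk c r].

Definition diameter A : R := sup [set eucl_dist x y | x in A & y in A].

Definition is_symmetry_center C k p :=
  C p /\ rotation (2 * pi / k%:R) p @` C = C.

Definition rotationally_symmetric C k :=
  (2 <= k)%N /\ exists p, is_symmetry_center C k p.

Definition multi_rotationally_symmetric C :=
  exists k l, [/\ k != l, rotationally_symmetric C k
                & rotationally_symmetric C l].

Definition is_minimal_degree C k :=
  rotationally_symmetric C k /\
  forall l, rotationally_symmetric C l -> (k <= l)%N.

(* Never holds for a disk, which has no maximal degree. *)
Definition is_maximal_degree C k :=
  rotationally_symmetric C k /\
  forall l, rotationally_symmetric C l -> (l <= k)%N.

(* [divisors] is duplicate-free and increasing. *)
Definition degrees k : seq nat := [seq d <- divisors k | (1 < d)%N].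

Definition spokes p x k : set (plane R) :=
  \bigcup_(j in [set j | (j < k)%N])
    segment p (rotation (2 * pi * j%:R / k%:R) p x).

(* The closed pieces into which a subset S divides C. *)
Definition pieces C (S : set (plane R)) : set (set (plane R)) :=
  [set closure (connected_component (C `\` S) y) | y in C `\` S].

(* The point of the frontier nearest to p need not be unique, even up to the
   symmetries of C, so being a standard k-partition is a predicate on P. *)
Definition standard_partition C k P :=
  (2 <= k)%N /\
  exists p x, [/\ is_symmetry_center C k p,
                  frontier C x,
                  forall y, frontier C y -> eucl_dist p x <= eucl_dist p y
                & P = pieces C (spokes p x k)].

(* A standard partition has finitely many pieces, so this is a maximum. *)
Definition max_relative_diameter P : R := sup [set diameter A | A in P].

End Plane.

(* Main.v *)
Require Import Defs.
From mathcomp Require Import all_boot all_order all_algebra.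
From mathcomp Require Import all_classical all_reals all_analysis.
From mathcomp Require Import ring lra zify.
Set Implicit Arguments.
Unset Strict Implicit.
Unset Printing Implicit Defensive.
Import Order.TTheory GRing.Theory Num.Theory.
Import numFieldNormedType.Exports.
Local Open Scope classical_set_scope.
Local Open Scope ring_scope.

(** Let p be the center of C and R its circumradius. The center is unique,
    because the vectors from p to the points of an orbit of a rotation about p
    sum to 0: if q is a point of C and C lies in the disk with center c and
    radius r, then some point q' of the orbit of q satisfies
    (q' - p) . (c - p) <= 0, so that |q - p|^2 + |c - p|^2 <= r^2
    ([orbit_disk]). Hence R is the largest distance from p to a point of C
    ([circumradius_center]), and no other point can be a center
    ([symmetry_center_unique]). Rotations about a common center compose, so
    the degrees of C are exactly the divisors of the maximal degree that are
    greater than 1 ([rotationally_symmetricP]).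

    The pieces of a standard k-partition, k >= 3, are the intersections of C
    with the closed sectors bounded by two consecutive spokes
    ([piece_sub_sector], [component_closure]). The reason is that p is
    interior to C ([center_interior]) and the spokes end on the frontier, so
    by convexity removing the spokes from C is the same as removing the rays
    that carry them; what is left of C in an open sector is convex, hence
    connected, and relatively clopen. Every piece therefore contains p, and
    some piece contains a point at distance R from p, which gives
    d_M(P_k) >= R ([circumradius_le_max_relative_diameter]).

    For k >= 6 a sector has an angle of at most pi / 3, and two points of such
    a sector at distance at most R from its apex are at distance at most R
    from each other ([narrow_sector]). So d_M(P_k) = R for k >= 6
    ([max_relative_diameter_ge6]).

    As chi divides kC properly and chi >= 3, kC >= 6 and d_M(P_kC) = R: if all
    the values are equal, they are equal to R. Conversely, let
    d_M(P_chi) = R. Since 2 is not a degree, kC is odd, and a degree other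
    than chi and smaller than 6 can only be 5, with chi = 3; then kC is a
    multiple of 15.
    But if C is both 3-symmetric and 3m-symmetric with m >= 3, then a closed
    sector of angle 2 pi / 3 contains m successive points of the orbit of a
    farthest point, and the extreme ones are seen from p under an angle
    greater than pi / 3. They are at a distance greater than R, so
    d_M(P_3) > R ([max_relative_diameter_3]), a contradiction.

    No polar angle of a point is needed: a sector bounded by u and v is
    the intersection of the half planes given by the signs of the cross
    products with u and v, which is correct as long as its angle is less
    than pi. *)

(** * Trigonometric estimates *)

Section Trigonometry.
Variable R : realType.
Implicit Type t : R.

Lemma cos_lt1 t : 0 < t -> t <= pi -> cos t < 1.
Proof.
move=> t0 tpi; rewrite -cos0 ltr_cos // in_itv /= ?lexx ?pi_ge0 //.
by rewrite tpi ltW.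
Qed.

Lemma sin_le0_pi t : pi <= t -> t <= 2 * pi -> sin t <= 0.
Proof.
move=> h1 h2; rewrite -oppr_ge0.
have -> : - sin t = sin (t - pi) by rewrite sinB cospi sinpi; ring.
by apply: sin_ge0_pi; apply/andP; split; lra.
Qed.

Lemma cos_pi3 : cos (pi / 3%:R) = 2^-1 :> R.
Proof.
set c := cos _.
have c0 : 0 < c.
  by apply: cos_gt0_pihalf; have := pi_gt0 R; lra.
(* The triple angle formula at pi / 3; the root c = -1 is excluded by c0. *)
have e : 4 * c ^+ 3 - 3 * c + 1 = 0.
  have := cospi R.
  have -> : pi = pi / 3%:R + (pi / 3%:R + pi / 3%:R) :> R by field.
  rewrite !cosD !sinD -/c; set s := sin _.
  have : c ^+ 2 + s ^+ 2 = 1 by apply: cos2Dsin2.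
  move=> h1 h2; have h3 : s ^+ 2 = 1 - c ^+ 2 by rewrite -h1; ring.
  have h4 : c * (c * c - s * s) - s * (s * c + c * s) = c ^+ 3 - 3 * c * s ^+ 2 by ring.
  by move: h2; rewrite h4 h3 => h2; lra.
have : (c + 1) * (2 * c - 1) ^+ 2 = 0 by rewrite -e; ring.
by move/eqP; rewrite mulf_eq0 sqrf_eq0 => /orP [/eqP|/eqP] h; lra.
Qed.

End Trigonometry.

(** * Dot and cross products, rotations about the origin *)

Section VectorAlgebra.
Variable R : realType.
Implicit Types (p q c u v w x y : plane R) (s t a b : R).

Definition dot u v : R := u 0 0 * v 0 0 + u 0 1 * v 0 1.
Definition cross u v : R := u 0 0 * v 0 1 - u 0 1 * v 0 0.
Definition turn t v : plane R :=
  \row_(j < 2) (if j == 0 then cos t * v 0 0 - sin t * v 0 1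
                else sin t * v 0 0 + cos t * v 0 1).

Lemma rotationE t p v : rotation t p v = p + turn t (v - p).
Proof. by []. Qed.

Lemma planeP u v : u 0 0 = v 0 0 -> u 0 1 = v 0 1 -> u = v.
Proof.
move=> e0 e1; apply/rowP => j.
case: j => [[|[|//]] lt].
  by have -> : Ordinal lt = 0 by apply: val_inj.
by have -> : Ordinal lt = 1 by apply: val_inj.
Qed.

Lemma turn0E t v : turn t v 0 0 = cos t * v 0 0 - sin t * v 0 1.
Proof. by rewrite mxE eqxx. Qed.

Lemma turn1E t v : turn t v 0 1 = sin t * v 0 0 + cos t * v 0 1.
Proof. by rewrite mxE. Qed.

Definition coordE := (turn0E, turn1E, mxE).

Lemma turnD t u v : turn t (u + v) = turn t u + turn t v.
Proof. by apply: planeP; rewrite !coordE /=; ring. Qed.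

Lemma turnZ t a v : turn t (a *: v) = a *: turn t v.
Proof. by apply: planeP; rewrite !coordE /=; ring. Qed.

Lemma turn0 v : turn 0 v = v.
Proof. by apply: planeP; rewrite !coordE /= cos0 sin0; ring. Qed.

Lemma turn_add s t v : turn s (turn t v) = turn (s + t) v.
Proof. by apply: planeP; rewrite !coordE /= cosD sinD; ring. Qed.

Lemma turn_pi2 v : turn (2 * pi) v = v.
Proof.
by apply: planeP; rewrite !coordE /= mulr_natl cos2pi sin2pi; ring.
Qed.

Lemma turn_pi2n t n v : turn (t + 2 * pi * n%:R) v = turn t v.
Proof.
elim: n => [|n IH]; first by rewrite mulr0 addr0.
have -> : t + 2 * pi * n.+1%:R = t + 2 * pi * n%:R + 2 * pi by rewrite -natr1; ring.
by rewrite -turn_add turn_pi2.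
Qed.

Lemma cross_turn s t v : cross (turn s v) (turn t v) = sin (t - s) * dot v v.
Proof. by rewrite /cross /dot !coordE /= sinB; ring. Qed.

Lemma dot_turn s t v : dot (turn s v) (turn t v) = cos (t - s) * dot v v.
Proof. by rewrite /dot !coordE /= cosB; ring. Qed.

Lemma sq_turn t v : dot (turn t v) (turn t v) = dot v v.
Proof. by rewrite dot_turn subrr cos0 mul1r. Qed.

Lemma sq_ge0 v : 0 <= dot v v.
Proof. by rewrite addr_ge0 // -expr2 sqr_ge0. Qed.

Lemma sq_eq0 v : (dot v v == 0) = (v == 0).
Proof.
apply/eqP/eqP => [|->]; last by rewrite /dot !mxE; ring.
move=> h; have h0 : v 0 0 ^+ 2 = 0.
  by apply/eqP; rewrite eq_le sqr_ge0 andbT -h /dot -!expr2 lerDl sqr_ge0.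
have h1 : v 0 1 ^+ 2 = 0.
  by apply/eqP; rewrite eq_le sqr_ge0 andbT -h /dot -!expr2 lerDr sqr_ge0.
move/eqP: h0; move/eqP: h1; rewrite !sqrf_eq0 => /eqP h1 /eqP h0.
by apply: planeP; rewrite ?h0 ?h1 mxE.
Qed.

Lemma sq_gt0 v : (0 < dot v v) = (v != 0).
Proof. by rewrite lt_def sq_eq0 sq_ge0 andbT. Qed.

Lemma eucl_distE x y : eucl_dist x y = Num.sqrt (dot (y - x) (y - x)).
Proof.
rewrite /eucl_dist; congr Num.sqrt.
have -> : \sum_(i < 2) (x 0 i - y 0 i) ^+ 2 =
    (x 0 0 - y 0 0) ^+ 2 + (x 0 1 - y 0 1) ^+ 2.
  rewrite !big_ord_recl big_ord0 addr0.
  by congr (_ + (_ - _) ^+ 2); congr (_ 0 _); apply: val_inj.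
by rewrite /dot !mxE; ring.
Qed.

Lemma eucl_dist_le x y (r : R) : 0 <= r ->
  (eucl_dist x y <= r) = (dot (y - x) (y - x) <= r ^+ 2).
Proof.
move=> r0; rewrite eucl_distE -(ler_sqr _ r0) ?nnegrE ?sqrtr_ge0 //.
by rewrite sqr_sqrtr // sq_ge0.
Qed.

Lemma sum_dot (k : nat) (F : nat -> plane R) u :
  \sum_(j < k) dot u (F j) = dot u (\sum_(j < k) F j).
Proof.
elim: k => [|k IH]; first by rewrite !big_ord0 /dot !mxE; ring.
by rewrite !big_ord_recr /= IH /dot !mxE; ring.
Qed.

Lemma turn_sum (k : nat) (F : nat -> plane R) t :
  turn t (\sum_(j < k) F j) = \sum_(j < k) turn t (F j).
Proof.
elim: k => [|k IH]; first by rewrite !big_ord0; apply: planeP; rewrite !coordE /=; ring.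
by rewrite !big_ord_recr /= turnD IH.
Qed.

(** The sum is fixed by the rotation of angle 2 pi / k, whose cosine is less
    than 1, so it can only be 0. *)
Lemma sum_orbit (k : nat) v : (2 <= k)%N ->
  \sum_(j < k) turn (2 * pi * j%:R / k%:R) v = 0.
Proof.
move=> k2; set S := \sum_(j < k) _.
have k0 : 0 < k%:R :> R by rewrite ltr0n; case: k k2 {S}.
have kn : k%:R != 0 :> R by rewrite gt_eqF.
pose t : R := 2 * pi / k%:R.
have St : turn t S = S.
  pose F (j : nat) := turn (2 * pi * j%:R / k%:R) v.
  have -> : turn t S = \sum_(j < k) F j.+1.
    rewrite (turn_sum k F); apply: eq_bigr => j _; rewrite /F turn_add.
    by congr turn; rewrite -natr1 /t; ring.
  have Fk : F k = F 0%N.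
    rewrite /F mulr0 mul0r turn0 -{2}(turn_pi2 v); congr turn.
    by rewrite -mulrA mulfV // mulr1.
  rewrite /S; case: k k2 k0 kn @t @F Fk {S} => // k _ _ _ t F Fk.
  by rewrite big_ord_recr /= Fk big_ord_recl /= addrC.
have c1 : cos t < 1.
  apply: cos_lt1; first by rewrite divr_gt0 // mulr_gt0 // pi_gt0.
  by rewrite /t ler_pdivrMr // mulrC ler_pM2l ?pi_gt0 // (ler_nat R 2 k).
apply/eqP; rewrite -sq_eq0.
have : cos t * dot S S = dot S S.
  by have := dot_turn 0 t S; rewrite subr0 turn0 St.
move/eqP; rewrite -subr_eq0 -{2}[dot S S]mul1r -mulrBl mulf_eq0 subr_eq0.
by rewrite (lt_eqF c1).
Qed.

Lemma exists_le0 (k : nat) (f : nat -> R) : (0 < k)%N -> \sum_(j < k) f j = 0 ->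
  exists2 j, (j < k)%N & f j <= 0.
Proof.
move=> k0 s0; apply: contrapT => H.
have P (j : 'I_k) : 0 < f j.
  by rewrite ltNge; apply/negP => fj; apply: H; exists (nat_of_ord j).
suff : 0 < \sum_(j < k) f j by rewrite s0 ltxx.
case: k k0 s0 H P => // k _ _ _ P; rewrite big_ord_recl ltr_pwDl ?(P ord0) //.
by apply: sumr_ge0 => j _; rewrite ltW.
Qed.

(** Otherwise a nonnegative term would be followed by positive terms only, and
    by periodicity the sum over a period would be positive. *)
Lemma cyclic_sign_change (k : nat) (f : nat -> R) : (0 < k)%N ->
  (forall j, f (j + k)%N = f j) -> \sum_(j < k) f j = 0 ->
  exists2 j, (j < k)%N & 0 <= f j /\ f j.+1 <= 0.
Proof.
move=> k0 fper s0; apply: contrapT => H.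
have step j : (j < k)%N -> 0 <= f j -> 0 < f j.+1.
  by move=> jk fj; rewrite ltNge; apply/negP => fj1; apply: H; exists j.
have stepm j : 0 <= f j -> 0 < f j.+1.
  rewrite (divn_eq j k); have : (j %% k < k)%N by rewrite ltn_mod.
  elim: (j %/ k)%N => [|m IH] jk; first by rewrite mul0n add0n; apply: step.
  have e : (m.+1 * k + j %% k = m * k + j %% k + k)%N by rewrite mulSn; ring.
  by rewrite e -addSn !fper; apply: IH.
have [i ik fi] : exists2 i, (i < k)%N & 0 <= f i.
  have : \sum_(j < k) (- f j) = 0 by rewrite sumrN s0 oppr0.
  by move=> /(@exists_le0 k (fun j => - f j) k0) [i ik]; rewrite oppr_le0; exists i.
have pos n : 0 < f (i + n).+1.
  elim: n => [|n IH]; first by rewrite addn0; apply: stepm.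
  by rewrite addnS; apply/stepm/ltW.
have [j jk] := exists_le0 k0 s0; apply/negP; rewrite -ltNge.
have := pos (j + k - i.+1)%N.
have -> : (i + (j + k - i.+1)).+1 = (j + k)%N.
  by rewrite -addSn subnKC // (leq_trans ik) // leq_addl.
by rewrite fper.
Qed.

End VectorAlgebra.

(** * Euclidean description of the topology of the plane *)

Section Topology.
Variable R : realType.
Implicit Types (A C : set (plane R)) (p q c u v w x y : plane R) (s t a b e : R).

Lemma convex_set_segment C u v t : convex_set C -> C u -> C v -> 0 <= t -> t <= 1 ->
  C ((1 - t) *: u + t *: v).
Proof.
move=> cC Cu Cv t0 t1.
have := cC v u (Itv01 t0 t1); rewrite !inE /= => /(_ Cv Cu).
by rewrite /conv /= addrC.
Qed.

(** The topology comes from the sup norm; squared Euclidean lengths are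
    preferable below because rotations preserve them. *)
Lemma nbhs_sqP p A :
  nbhs p A <-> exists2 e, 0 < e & forall y, dot (y - p) (y - p) < e -> A y.
Proof.
split=> [/nbhs_ballP [e /= e0 eA]|[e e0 eA]].
  exists (e ^+ 2); first by rewrite exprn_gt0.
  move=> y ye; apply: eA; split => // i j; rewrite (ord1 i) {i} /ball /=.
  have h z : z ^+ 2 <= dot (y - p) (y - p) -> `|z| < e.
    move=> zy; rewrite -(ltr_sqr _ _) ?nnegrE ?(ltW e0) // real_normK ?num_real //.
    exact: le_lt_trans zy ye.
  have [->|->] : j = 0 \/ j = 1.
    by case: j => [[|[|//]] lt]; [left|right]; apply: val_inj.
    apply: h; rewrite /dot !mxE.
    have := sqr_ge0 (y 0 1 - p 0 1); nra.
  apply: h; rewrite /dot !mxE.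
  have := sqr_ge0 (y 0 0 - p 0 0); nra.
apply/nbhs_ballP; exists (Num.sqrt (e / 2)) => /=; first by rewrite sqrtr_gt0 divr_gt0.
move=> y yb; apply: eA.
have h j : (p 0 j - y 0 j) ^+ 2 < e / 2.
  have := yb.2 0 j; rewrite /ball /= => hj.
  rewrite -(sqr_sqrtr (divr_ge0 (ltW e0) (ler0n R 2))).
  by rewrite -[X in X < _]real_normK ?num_real // ltr_sqr ?nnegrE ?sqrtr_ge0.
have := h 0; have := h 1; rewrite /dot !mxE => h1 h0; nra.
Qed.

Lemma closure_sqP A x : closure A x <->
  forall e, 0 < e -> exists2 y, A y & dot (y - x) (y - x) < e.
Proof.
split=> [cA e e0|H B /nbhs_sqP [e e0 eB]].
  have [|y [Ay By]] := cA [set y | dot (y - x) (y - x) < e].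
    by apply/nbhs_sqP; exists e.
  by exists y.
by have [y Ay ye] := H e e0; exists y; split => //; apply: eB.
Qed.

Lemma cvg_coordB p v (i : 'I_2) :
  (fun w : plane R => w 0 i - p 0 i) @ v --> v 0 i - p 0 i.
Proof.
exact: (@cvgB _ _ _ _ _ (fun w : plane R => w 0 i) (fun=> p 0 i) _ _
  (@coord_continuous R 1 2 0 i v) (cvg_cst _)).
Qed.

Lemma continuous_cross u p : continuous (fun v => cross u (v - p)).
Proof.
move=> v.
have -> : (fun v => cross u (v - p)) =
  (fun v : plane R => u 0 0 * (v 0 1 - p 0 1)) -
  (fun v : plane R => u 0 1 * (v 0 0 - p 0 0)).
  by apply/funext => w; rewrite /cross !mxE.
have h a (i : 'I_2) : (fun v => a * (v 0 i - p 0 i)) @ v --> a * (v 0 i - p 0 i).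
  exact: (@cvgM _ _ _ _ (fun=> a) (fun v => v 0 i - p 0 i) _ _ (cvg_cst _)
    (@cvg_coordB p v i)).
exact: (cvgB (h _ _) (h _ _)).
Qed.

Lemma continuous_sq p : continuous (fun v => dot (v - p) (v - p)).
Proof.
move=> v.
have -> : (fun v => dot (v - p) (v - p)) =
    (fun v : plane R => (v 0 0 - p 0 0) * (v 0 0 - p 0 0)) +
    (fun v : plane R => (v 0 1 - p 0 1) * (v 0 1 - p 0 1)).
  by apply/funext => w; rewrite /dot !mxE.
have h (i : 'I_2) : (fun v => (v 0 i - p 0 i) * (v 0 i - p 0 i)) @ v -->
    (v 0 i - p 0 i) * (v 0 i - p 0 i).
  exact: (cvgM (@cvg_coordB p v i) (@cvg_coordB p v i)).
exact: (cvgD (h _) (h _)).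
Qed.

Lemma connected_segment x y : connected (segment x y).
Proof.
apply: connected_continuous_connected; first exact: segment_connected.
apply: continuous_subspaceT => t.
apply: (@cvgD _ _ _ _ _ (fun t => (1 - t) *: x) (fun t => t *: y)).
  apply: cvgZr_tmp.
  have h1 : (fun=> 1 : R) @ t --> (1 : R) by exact: cvg_cst.
  have h2 : (fun t : R => t) @ t --> t by exact: cvg_id.
  exact: (cvgB h1 h2).
by apply: cvgZr_tmp; exact: cvg_id.
Qed.
End Topology.

(** * Center of symmetry and circumradius *)

Section RotationalSymmetry.
Variable R : realType.
Implicit Types (A C : set (plane R)) (p q c u v w x y : plane R) (s t r a b e : R).

(** Only the inclusion of the image in C is asked for: it is the form in which
    stability adds up over angles, and for the angles 2 pi / k it implies
    equality. *)
Definition turn_stable C p t := forall y, C y -> C (p + turn t (y - p)).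

Lemma turn_stableD C p s t :
  turn_stable C p s -> turn_stable C p t -> turn_stable C p (s + t).
Proof.
move=> hs ht y /ht /hs; rewrite -turn_add.
by rewrite [p + turn t _ - p]addrC addKr.
Qed.

Lemma turn_stable_mul C p t n : turn_stable C p t -> turn_stable C p (t * n%:R).
Proof.
move=> ht; elim: n => [|n IH]; first by move=> y; rewrite mulr0 turn0 addrC subrK.
by rewrite -natr1 mulrDr mulr1; apply: turn_stableD.
Qed.

Lemma turn_stable_pi2 C p t n :
  turn_stable C p (t + 2 * pi * n%:R) <-> turn_stable C p t.
Proof. by split=> h y /h; rewrite turn_pi2n. Qed.

(** Turning k - 1 times by 2 pi / k amounts to turning back once. *)
Lemma turn_stableN C p k : (0 < k)%N ->
  turn_stable C p (2 * pi / k%:R) -> turn_stable C p (- (2 * pi / k%:R)).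
Proof.
move=> k0 /(@turn_stable_mul _ _ _ k.-1) h.
apply/(@turn_stable_pi2 _ _ _ 1); suff -> : - (2 * pi / k%:R) + 2 * pi * 1%:R =
   2 * pi / k%:R * k.-1%:R :> R by [].
case: k k0 {h} => // k _ /=.
have : k.+1%:R != 0 :> R by rewrite pnatr_eq0.
by rewrite -natr1 => k1; field.
Qed.

Lemma is_symmetry_centerP C k p : (0 < k)%N ->
  is_symmetry_center C k p <-> C p /\ turn_stable C p (2 * pi / k%:R).
Proof.
move=> k0; split=> [[Cp rC]|[Cp sC]]; split => //.
  by move=> y Cy; rewrite -rC; exists y.
apply/seteqP; split => [_ [y Cy <-]|y Cy]; first exact: sC.
exists (p + turn (- (2 * pi / k%:R)) (y - p)); first exact: turn_stableN.
rewrite rotationE [p + turn _ _ - p]addrC addKr turn_add subrr turn0.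
by rewrite addrC subrK.
Qed.

Lemma orbit_stable C p k j y : turn_stable C p (2 * pi / k%:R) -> C y ->
  C (p + turn (2 * pi * j%:R / k%:R) (y - p)).
Proof.
move=> /(@turn_stable_mul _ _ _ j) h /h.
by have -> : 2 * pi / k%:R * j%:R = 2 * pi * j%:R / k%:R :> R by ring.
Qed.

(** Some point of the orbit of q lies on the side of p opposite to c, because
    the orbit has p as its barycenter; Pythagoras applied to this point gives
    the bound. *)
Lemma orbit_disk C p k q c r : (2 <= k)%N ->
  turn_stable C p (2 * pi / k%:R) -> C q -> 0 <= r -> C `<=` disk c r ->
  dot (q - p) (q - p) + dot (c - p) (c - p) <= r ^+ 2.
Proof.
move=> k2 sC Cq r0 Cr.
pose F (j : nat) := turn (2 * pi * j%:R / k%:R) (q - p).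
have := sum_dot k F (c - p).
have -> : \sum_(j < k) F j = 0 by apply: sum_orbit.
have -> : dot (c - p) 0 = 0 by rewrite /dot !mxE !mulr0 addr0.
have k0 : (0 < k)%N by apply: leq_trans k2.
move=> /(@exists_le0 _ _ (fun j => dot (c - p) (F j)) k0) [j _ dj].
have := Cr _ (orbit_stable j sC Cq); rewrite /disk /= eucl_dist_le // => h.
apply: le_trans h.
rewrite -(sq_turn (2 * pi * j%:R / k%:R) (q - p)) -/(F j).
have -> : dot (p + F j - c) (p + F j - c) =
  dot (F j) (F j) + dot (c - p) (c - p) - 2 * dot (c - p) (F j).
  by rewrite /dot !mxE; ring.
by rewrite lerDl oppr_ge0; nra.
Qed.

Lemma circumradius_center C p k : compact C -> C p -> (2 <= k)%N ->
  turn_stable C p (2 * pi / k%:R) ->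
  [/\ 0 <= circumradius C,
      forall y, C y -> dot (y - p) (y - p) <= circumradius C ^+ 2 &
      exists2 q, C q & dot (q - p) (q - p) = circumradius C ^+ 2].
Proof.
move=> cC Cp k2 sC.
have [||q] := @compact_EVT_max _ _ (fun v => dot (v - p) (v - p)) C _ cC.
- by exists p.
- by apply: continuous_subspaceT; exact: continuous_sq.
rewrite inE => Cq qmax.
pose M := Num.sqrt (dot (q - p) (q - p)).
have M0 : 0 <= M by apply: sqrtr_ge0.
have M2 : M ^+ 2 = dot (q - p) (q - p) by rewrite sqr_sqrtr ?sq_ge0.
pose E := [set r : R | 0 <= r /\ exists c, C `<=` disk c r].
have EM : E M.
  split => //; exists p => y Cy; rewrite /disk /= eucl_dist_le // M2.
  by apply: qmax; rewrite inE.
have lbE : lbound E M.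
  move=> r [r0 [c Cr]]; rewrite -(ler_sqr (x := M)) ?nnegrE // M2.
  by apply: le_trans (orbit_disk k2 sC Cq r0 Cr); rewrite lerDl sq_ge0.
have -> : circumradius C = M.
  apply/eqP; rewrite eq_le; apply/andP; split.
    by apply: ge_inf => //; exists M.
  by apply: lb_le_inf => //; exists M.
split => //; last by exists q.
by move=> y Cy; rewrite M2; apply: qmax; rewrite inE.
Qed.

(** The disk about p' of radius the circumradius contains C, and C has a point
    at that distance from p: [orbit_disk] then leaves |p' - p|^2 <= 0. *)
Lemma symmetry_center_unique C p k p' k' : compact C ->
  C p -> (2 <= k)%N -> turn_stable C p (2 * pi / k%:R) ->
  C p' -> (2 <= k')%N -> turn_stable C p' (2 * pi / k'%:R) -> p = p'.
Proof.
move=> cC Cp k2 sC Cp' k2' sC'.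
have [R0 _ [q Cq qR]] := circumradius_center cC Cp k2 sC.
have [_ le' _] := circumradius_center cC Cp' k2' sC'.
have := orbit_disk (c := p') k2 sC Cq R0.
rewrite qR => H; apply/esym/eqP; rewrite -subr_eq0 -sq_eq0 eq_le sq_ge0 andbT.
rewrite -(lerD2l (circumradius C ^+ 2)) addr0; apply: H => y Cy.
by rewrite /disk /= eucl_dist_le //; apply: le'.
Qed.

Lemma convex_average C (F : nat -> plane R) n : convex_set C ->
  (forall j, C (F j)) -> C (n.+1%:R^-1 *: \sum_(j < n.+1) F j).
Proof.
move=> cC CF; elim: n => [|n IH].
  by rewrite big_ord_recr big_ord0 /= add0r invr1 scale1r.
rewrite big_ord_recr /= scalerDr.
have n0 : n.+2%:R^-1 <= 1 :> R by rewrite invf_le1 ?ler1n ?ltr0n.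
have := convex_set_segment cC IH (CF n.+1) _ n0; rewrite invr_ge0 ler0n => /(_ isT).
rewrite scalerA; congr (C (_ *: _ + _)).
rewrite -[n.+2%:R]natr1 -[n.+1%:R]natr1.
have : 0 <= n%:R :> R by [].
by move: (n%:R : R) => m m0; field; apply/andP; split; apply: lt0r_neq0; lra.
Qed.

(** The average of the points p + turn (2 pi j / k) (z - p) + (y - p) is y.
    When z is interior and y is close to p, all of them belong to C, since each
    is the image of a point close to z. *)
Lemma center_interior C p k : convex_set C -> C° !=set0 -> (2 <= k)%N ->
  turn_stable C p (2 * pi / k%:R) -> C° p.
Proof.
move=> cC [z /nbhs_sqP [e e0 ze]] k2 sC; apply/nbhs_sqP; exists e => // y ye.
pose F (j : nat) := p + turn (2 * pi * j%:R / k%:R) (z - p) + (y - p).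
have CF j : C (F j).
  pose t : R := 2 * pi * j%:R / k%:R.
  have -> : F j = p + turn t (z + turn (- t) (y - p) - p).
    have -> : z + turn (- t) (y - p) - p = (z - p) + turn (- t) (y - p).
      by rewrite addrAC.
    by rewrite turnD turn_add subrr turn0 addrA.
  apply: orbit_stable => //; apply: ze.
  by rewrite addrAC subrr add0r sq_turn.
case: k k2 sC @F CF => // k k2 sC F CF.
have := convex_average k cC CF.
have -> // : k.+1%:R^-1 *: \sum_(j < k.+1) F j = y.
rewrite 2!big_split /= (sum_orbit _ k2) addr0 -big_split /= sumr_const card_ord.
by rewrite addrC subrK -(scaler_nat k.+1 y) scalerA mulVf ?scale1r // pnatr_eq0.
Qed.

End RotationalSymmetry.

(** * Sectors of angle less than pi *)

Section Sectors.
Variable R : realType.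
Implicit Types (A C : set (plane R)) (p q c u v w x y : plane R) (s t r a b e : R).

(** When 0 < cross u v, these are the sectors with apex p swept
    counterclockwise from the ray of direction u to the ray of direction v. *)
Definition closed_sector p u v : set (plane R) :=
  [set y | 0 <= cross u (y - p) /\ 0 <= cross (y - p) v].

Definition open_sector p u v : set (plane R) :=
  [set y | 0 < cross u (y - p) /\ 0 < cross (y - p) v].

Lemma crossC u v : cross u v = - cross v u.
Proof. by rewrite /cross; ring. Qed.

Lemma cross_decomposition u v w :
  cross u v *: w = cross w v *: u + cross u w *: v.
Proof. by apply: planeP; rewrite /cross !mxE; ring. Qed.

Lemma sum_cross (k : nat) (F : nat -> plane R) w :
  \sum_(j < k) cross (F j) w = cross (\sum_(j < k) F j) w.
Proof.
elim: k => [|k IH]; first by rewrite !big_ord0 /cross !mxE; ring.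
by rewrite !big_ord_recr /= IH /cross !mxE; ring.
Qed.

Lemma open_sector_closed p u v : open_sector p u v `<=` closed_sector p u v.
Proof. by move=> y [h1 h2]; split; apply: ltW. Qed.

Lemma closed_closed_sector p u v : closed (closed_sector p u v).
Proof.
have -> : closed_sector p u v =
   (fun y => cross u (y - p)) @^-1` [set z | 0 <= z] `&`
   (fun y => cross v (y - p)) @^-1` [set z | z <= 0].
  by apply/seteqP; split=> y /=; rewrite /closed_sector /= (crossC (y - p) v) oppr_ge0.
apply: closedI; apply: preimage_closed.
- by move=> y _; exact: continuous_cross.
- exact: closed_ge.
- by move=> y _; exact: continuous_cross.
- exact: closed_le.
Qed.

Lemma open_open_sector p u v : open (open_sector p u v).
Proof.
have -> : open_sector p u v =
   (fun y => cross u (y - p)) @^-1` [set z | 0 < z] `&`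
   (fun y => cross v (y - p)) @^-1` [set z | z < 0].
  by apply/seteqP; split=> y /=; rewrite /open_sector /= (crossC (y - p) v) oppr_gt0.
apply: openI; apply: open_comp.
- by move=> y _; exact: continuous_cross.
- exact: open_gt.
- by move=> y _; exact: continuous_cross.
- exact: open_lt.
Qed.

Lemma closed_sector_boundary p u v y : 0 < cross u v ->
  closed_sector p u v y -> ~ open_sector p u v y ->
  exists2 a, 0 <= a & y - p = a *: u \/ y - p = a *: v.
Proof.
move=> uv [h1 h2] no.
have uvn : cross u v != 0 by rewrite gt_eqF.
have dec := cross_decomposition u v (y - p).
have [e1|n1] := eqVneq (cross u (y - p)) 0.
  exists (cross (y - p) v / cross u v); first by rewrite divr_ge0 // ltW.
  left; apply: (scalerI uvn); rewrite dec e1 scale0r addr0 scalerA.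
  by rewrite mulrC divfK.
have [e2|n2] := eqVneq (cross (y - p) v) 0.
  exists (cross u (y - p) / cross u v); first by rewrite divr_ge0 // ltW.
  right; apply: (scalerI uvn); rewrite dec e2 scale0r add0r scalerA.
  by rewrite mulrC divfK.
by case: no; split; rewrite lt_def ?n1 ?n2.
Qed.

Lemma sector_segment p u v y w t : closed_sector p u v y -> open_sector p u v w ->
  0 < t -> t <= 1 -> open_sector p u v ((1 - t) *: y + t *: w).
Proof.
move=> [y1 y2] [w1 w2] t0 t1; split.
  have -> : cross u ((1 - t) *: y + t *: w - p) =
    (1 - t) * cross u (y - p) + t * cross u (w - p) by rewrite /cross !mxE; ring.
  by rewrite ltr_wpDl ?mulr_gt0 ?mulr_ge0 // subr_ge0.
have -> : cross ((1 - t) *: y + t *: w - p) v =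
    (1 - t) * cross (y - p) v + t * cross (w - p) v by rewrite /cross !mxE; ring.
by rewrite ltr_wpDl ?mulr_gt0 ?mulr_ge0 // subr_ge0.
Qed.

Lemma closed_sector_cone p u v y : 0 < cross u v -> closed_sector p u v y ->
  exists a b, [/\ 0 <= a, 0 <= b & y - p = a *: u + b *: v].
Proof.
move=> uv [h1 h2]; have uvn : cross u v != 0 by rewrite gt_eqF.
exists (cross (y - p) v / cross u v), (cross u (y - p) / cross u v).
split; try by rewrite divr_ge0 // ltW.
apply: (scalerI uvn); rewrite cross_decomposition scalerDr !scalerA.
by congr (_ *: _ + _ *: _); rewrite mulrC divfK.
Qed.

(** The hypotheses say that u and v have the same length and make an angle of
    at most pi / 3. In coordinates along u and v, if the two differences of
    coordinates have the same sign then y - w, up to sign, has smaller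
    coordinates than y or w; if they have opposite signs then y - w is at most
    as long as the longer of its two components, which is no longer than y
    or w. *)
Lemma narrow_sector u v y w r : 0 < cross u v -> dot u u = dot v v ->
  dot u u <= 2 * dot u v ->
  closed_sector 0 u v y -> closed_sector 0 u v w ->
  dot y y <= r ^+ 2 -> dot w w <= r ^+ 2 -> dot (y - w) (y - w) <= r ^+ 2.
Proof.
move=> uv uuvv.
have dec := closed_sector_cone uv.
move=> uv60 /dec [a [b]]; rewrite subr0 => -[a0 b0 ->].
move=> /dec [a' [b']]; rewrite subr0 => -[a0' b0' ->].
have dE s t : dot (s *: u + t *: v) (s *: u + t *: v) =
  dot u u * (s ^+ 2 + t ^+ 2) + 2 * (s * t) * dot u v.
  have -> : dot (s *: u + t *: v) (s *: u + t *: v) =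
    dot u u * s ^+ 2 + dot v v * t ^+ 2 + 2 * (s * t) * dot u v.
    by rewrite /dot !mxE; ring.
  by rewrite -uuvv; ring.
have -> : a *: u + b *: v - (a' *: u + b' *: v) = (a - a') *: u + (b - b') *: v.
  by apply: planeP; rewrite !mxE; ring.
rewrite !dE.
have D0 := sq_ge0 u.
move: (dot u u) (dot u v) uv60 D0 => D g g2 D0 {dE dec uuvv uv}.
have g0 : 0 <= g by lra.
move: (r ^+ 2) => M {r}.
wlog aa : a a' b b' a0 a0' b0 b0' / a' <= a.
  move=> W h h'; have [aa|/ltW aa] := lerP a' a; first exact: W.
  have -> : D * ((a - a') ^+ 2 + (b - b') ^+ 2) + 2 * ((a - a') * (b - b')) * g =
    D * ((a' - a) ^+ 2 + (b' - b) ^+ 2) + 2 * ((a' - a) * (b' - b)) * g by ring.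
  exact: W.
move=> h h'; have A0 : 0 <= a - a' by rewrite subr_ge0.
have [bb|/ltW bb] := lerP b' b.
  have B0 : 0 <= b - b' by rewrite subr_ge0.
  apply: le_trans h; apply: lerD.
    by apply: ler_wpM2l => //; apply: lerD; rewrite ler_sqr ?nnegrE // lerBlDr lerDl.
  apply: ler_wpM2r => //; apply: ler_wpM2l => //.
  by apply: ler_pM => //; rewrite lerBlDr lerDl.
have B0 : 0 <= b' - b by rewrite subr_ge0.
(* Opposite signs: the cross term is at most -D |a - a'| |b - b'|. *)
have key : D * ((a - a') ^+ 2 + (b - b') ^+ 2) + 2 * ((a - a') * (b - b')) * g <=
  D * ((a - a') ^+ 2 + (b' - b) ^+ 2 - (a - a') * (b' - b)).
  have : 0 <= (a - a') * (b' - b) * (2 * g - D) by rewrite !mulr_ge0 // subr_ge0.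
  by nra.
apply: le_trans key _.
have [AB|/ltW AB] := lerP (b' - b) (a - a').
  apply: le_trans h.
  have h1 : 0 <= a * b * g by rewrite !mulr_ge0.
  have h2 : 0 <= (b' - b) * (a - a' - (b' - b)) by rewrite mulr_ge0 // subr_ge0.
  have h3 : (a - a') ^+ 2 <= a ^+ 2 by rewrite ler_sqr ?nnegrE // lerBlDr lerDl.
  have h4 := sqr_ge0 b.
  have : D * ((a - a') ^+ 2 + (b' - b) ^+ 2 - (a - a') * (b' - b)) <=
      D * (a ^+ 2 + b ^+ 2).
    by apply: ler_wpM2l => //; nra.
  by nra.
apply: le_trans h'.
have h1 : 0 <= a' * b' * g by rewrite !mulr_ge0.
have h2 : 0 <= (a - a') * (b' - b - (a - a')) by rewrite mulr_ge0 // subr_ge0.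
have h3 : (b' - b) ^+ 2 <= b' ^+ 2 by rewrite ler_sqr ?nnegrE // lerBlDr lerDl.
have h4 := sqr_ge0 a'.
have : D * ((a - a') ^+ 2 + (b' - b) ^+ 2 - (a - a') * (b' - b)) <=
    D * (a' ^+ 2 + b' ^+ 2).
  by apply: ler_wpM2l => //; nra.
by nra.
Qed.

End Sectors.

(** * Bounds on diameters *)

Section Diameters.
Variable R : realType.
Implicit Types (A C : set (plane R)) (P : set (set (plane R))) (r : R).

Lemma diameter_le A r : A !=set0 ->
  (forall u v, A u -> A v -> eucl_dist u v <= r) -> diameter A <= r.
Proof.
move=> [a Aa] Ar; apply: ge_sup.
  by exists (eucl_dist a a); exists a => //; exists a.
by move=> _ [u Au [v Av <-]]; apply: Ar.
Qed.

Lemma diameter_ge A r u v :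
  (forall u v, A u -> A v -> eucl_dist u v <= r) ->
  A u -> A v -> eucl_dist u v <= diameter A.
Proof.
move=> Ar Au Av; apply: ub_le_sup; last by exists u => //; exists v.
by exists r => _ [u' Au' [v' Av' <-]]; apply: Ar.
Qed.

End Diameters.

(** * Pieces of a standard partition *)

Section StandardPartition.
Variables (R : realType) (C : set (plane R)) (p x : plane R) (k : nat).
Implicit Types (u v w y : plane R) (s t a e : R).
Hypotheses (cC : compact C) (vC : convex_set C) (k3 : (3 <= k)%N).
Hypotheses (pI : C° p) (sC : turn_stable C p (2 * pi / k%:R)).
Hypothesis xF : frontier C x.

(** Defined for every j, not only j < k, so that the last sector, between the
    spokes k - 1 and 0, needs no special treatment. *)
Definition spoke_dir j : plane R := turn (2 * pi * j%:R / k%:R) (x - p).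
Local Notation d := spoke_dir.
Local Notation S := (spokes p x k).
Local Notation sector j := (open_sector p (d j) (d j.+1)).
Local Notation csector j := (closed_sector p (d j) (d j.+1)).

Let k0 : (0 < k)%N. Proof. exact: leq_trans k3. Qed.
Let kn : k%:R != 0 :> R. Proof. by rewrite pnatr_eq0 -lt0n k0. Qed.
Let kp : 0 < k%:R :> R. Proof. by rewrite ltr0n k0. Qed.
Let clC : closed C. Proof. by apply: compact_closed => //; apply: norm_hausdorff. Qed.
Let Cp : C p. Proof. exact: interior_subset pI. Qed.

Lemma frontier_mem : C x.
Proof. by have [+ _] := xF; rewrite -(closure_id C).1. Qed.

Lemma frontier_neq_center : 0 < dot (x - p) (x - p).
Proof.
rewrite sq_gt0 subr_eq0; apply/eqP => xp; have [_] := xF.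
by rewrite xp.
Qed.

Lemma spoke_dirD j : d (j + k) = d j.
Proof.
rewrite /spoke_dir -[RHS](turn_pi2n _ 1); congr turn.
by rewrite natrD; field.
Qed.

Lemma spoke_dir_mod j : d (j %% k) = d j.
Proof.
rewrite {2}(divn_eq j k); elim: (j %/ k)%N => [|m IH]; first by rewrite mul0n add0n.
by rewrite mulSn -addnA addnC spoke_dirD.
Qed.

Lemma sin_step_gt0 : 0 < sin (2 * pi / k%:R : R).
Proof.
apply: sin_gt0_pi; rewrite divr_gt0 ?mulr_gt0 ?pi_gt0 //=.
by rewrite ltr_pdivrMr // mulrC ltr_pM2l ?pi_gt0 // (ltr_nat R 2 k).
Qed.

Lemma spoke_dir_cross j : 0 < cross (d j) (d j.+1).
Proof.
rewrite cross_turn mulr_gt0 ?frontier_neq_center //.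
have -> : 2 * pi * j.+1%:R / k%:R - 2 * pi * j%:R / k%:R = 2 * pi / k%:R :> R.
  by rewrite -natr1; field.
exact: sin_step_gt0.
Qed.

Lemma spoke_end j : C (p + d j).
Proof. exact: orbit_stable sC frontier_mem. Qed.

(** A point of C beyond the end of a spoke would put that end, hence x by
    rotation, in the interior of C: x would lie strictly between a point of C
    and the interior point p. *)
Lemma ray_frontier_bound y j a : C y -> y - p = a *: d j -> a <= 1.
Proof.
move=> Cy ya; rewrite leNgt; apply/negP => a1; have [_] := xF; apply.
have a0 : 0 < a by apply: lt_trans a1.
pose y' := p + turn (- (2 * pi / k%:R) * j%:R) (y - p).
have Cy' : C y' by apply: (turn_stable_mul _ (turn_stableN k0 sC)).
have y'a : y' = p + a *: (x - p).
  rewrite /y' ya turnZ turn_add; congr (p + a *: _).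
  by rewrite -[RHS]turn0; congr turn; ring.
move/nbhs_sqP: pI => [e e0 pe]; apply/nbhs_sqP.
pose b := 1 - a^-1.
have b0 : 0 < b by rewrite subr_gt0 invf_lt1.
exists (b ^+ 2 * e) => [|y0 ye]; first by rewrite mulr_gt0 ?exprn_gt0.
(* y0 is a convex combination of y' and a point close to p. *)
have Cz : C (p + b^-1 *: (y0 - x)).
  apply: pe; rewrite addrAC subrr add0r.
  have -> : dot (b^-1 *: (y0 - x)) (b^-1 *: (y0 - x)) =
      (b ^+ 2)^-1 * dot (y0 - x) (y0 - x).
    by rewrite /dot !mxE -exprVn; ring.
  by rewrite mulrC ltr_pdivrMr ?exprn_gt0 // mulrC.
have ai0 : 0 <= a^-1 by rewrite invr_ge0 ltW.
have ai1 : a^-1 <= 1 by rewrite invf_le1 // ltW.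
have := convex_set_segment vC Cz Cy' ai0 ai1.
have -> // : (1 - a^-1) *: (p + b^-1 *: (y0 - x)) + a^-1 *: y' = y0.
have an : (a != 0) && (a - 1 != 0) by rewrite gt_eqF //= gt_eqF // subr_gt0.
by rewrite y'a -/b; apply: planeP; rewrite !mxE /b; field.
Qed.

Lemma ray_spoke y j a : C y -> 0 <= a -> y - p = a *: d j -> S y.
Proof.
move=> Cy a0 ya; exists (j %% k)%N => /=; first by rewrite ltn_mod.
exists a => /=; first by rewrite in_itv /= a0 (ray_frontier_bound Cy ya).
rewrite rotationE -/(d _) spoke_dir_mod.
have -> : y = p + a *: d j by rewrite -ya addrC subrK.
by apply: planeP; rewrite !mxE; ring.
Qed.

(** The cross products of the spoke directions with y - p sum to 0 over a turn,
    so they pass from nonnegative to nonpositive between two consecutive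
    spokes. *)
Lemma sector_cover y : exists2 j, (j < k)%N & csector j y.
Proof.
have s0 : \sum_(j < k) cross (d j) (y - p) = 0.
  rewrite (sum_cross k d) sum_orbit; first by rewrite /cross !mxE; ring.
  exact: ltnW.
have per j : cross (d (j + k)) (y - p) = cross (d j) (y - p) by rewrite spoke_dirD.
have [j jk [h1 h2]] :=
  cyclic_sign_change (f := fun j => cross (d j) (y - p)) k0 per s0.
by exists j => //; split; rewrite // crossC oppr_ge0.
Qed.

Lemma sector_interior_off_spokes y j : C y -> ~ S y -> csector j y -> sector j y.
Proof.
move=> Cy nSy cy; apply: contrapT => ny; apply: nSy.
have [a a0 [ya|ya]] := closed_sector_boundary (spoke_dir_cross j) cy ny.
  exact: ray_spoke ya.
exact: ray_spoke ya.
Qed.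

(** With al = 2 pi / k, the cross products have the signs of
    sin ((i - j) al) and sin ((j + 1 - i) al), and no integer multiple of al
    lies strictly between 0 and al modulo 2 pi. *)
Lemma spoke_not_in_sector i j : (i < k)%N -> (j < k)%N ->
  0 < cross (d j) (d i) -> cross (d i) (d j.+1) <= 0.
Proof.
move=> ik jk; rewrite !cross_turn pmulr_lgt0 ?frontier_neq_center // => h.
apply: mulr_le0_ge0; last by rewrite ltW ?frontier_neq_center.
set al : R := 2 * pi / k%:R.
have al0 : 0 < al by rewrite divr_gt0 ?mulr_gt0 ?pi_gt0.
have alk : al * k%:R = 2 * pi by rewrite /al divfK.
have e1 : 2 * pi * i%:R / k%:R - 2 * pi * j%:R / k%:R =
  al * i%:R - al * j%:R by rewrite /al; ring.
have e2 : 2 * pi * j.+1%:R / k%:R - 2 * pi * i%:R / k%:R =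
    al * j%:R + al - al * i%:R.
  by rewrite -natr1 /al; ring.
move: h; rewrite {}e1 {}e2.
have [ij|ji] := ltnP i j.
  have [n nj] : exists n, j = (i + n)%N by exists (j - i)%N; rewrite subnKC // ltnW.
  have nk : al * n%:R + al <= 2 * pi.
    rewrite -alk -{2}[al]mulr1 -mulrDr natr1 ler_pM2l // ler_nat.
    by apply: leq_ltn_trans jk; rewrite nj leq_addl.
  have -> : al * i%:R - al * j%:R = - (al * n%:R) by rewrite nj natrD; ring.
  have -> : al * j%:R + al - al * i%:R = al * n%:R + al by rewrite nj natrD; ring.
  rewrite sinN oppr_gt0 => h; apply: sin_le0_pi => //.
  apply: ler_wpDr; first exact: ltW.
  rewrite leNgt; apply/negP => npi; move: h; apply/negP; rewrite -leNgt.
  by apply: sin_ge0_pi; rewrite (ltW npi) mulr_ge0 // ltW.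
have [n ni] : exists n, i = (j + n)%N by exists (i - j)%N; rewrite subnKC.
have nk : al * n%:R <= 2 * pi.
  by rewrite -alk ler_pM2l // ler_nat ltnW // (leq_ltn_trans _ ik) // ni leq_addl.
have -> : al * i%:R - al * j%:R = al * n%:R by rewrite ni natrD; ring.
have -> : al * j%:R + al - al * i%:R = al - al * n%:R by rewrite ni natrD; ring.
case: n {ni} nk => [|n] nk h; first by move: h; rewrite mulr0 sin0 ltxx.
have -> : al - al * n.+1%:R = - (al * n%:R) by rewrite -natr1; ring.
rewrite sinN oppr_le0; apply: sin_ge0_pi; rewrite mulr_ge0 ?(ltW al0) //=; apply: ltW.
apply: (@le_lt_trans _ _ (al * n.+1%:R)); first by rewrite ler_pM2l // ler_nat.
rewrite ltNge; apply/negP => npi; move: h; apply/negP; rewrite -leNgt.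
exact: sin_le0_pi.
Qed.

Lemma sector_disjoint_spokes y j : (j < k)%N -> sector j y -> ~ S y.
Proof.
move=> jk [y1 y2] [i /= ik [t /=]]; rewrite in_itv /= => /andP [t0 t1].
rewrite rotationE -/(d i) => yE.
have yp : y - p = t *: d i by rewrite -yE; apply: planeP; rewrite !mxE; ring.
have cl u : cross u (t *: d i) = t * cross u (d i) by rewrite /cross !mxE; ring.
have cr u : cross (t *: d i) u = t * cross (d i) u by rewrite /cross !mxE; ring.
move: y1 y2; rewrite yp cl cr => y1 y2.
have tp : 0 < t.
  by rewrite lt_neqAle t0 andbT; apply: contraTneq y1 => <-; rewrite mul0r ltxx.
move: y1 y2; rewrite !pmulr_rgt0 // => y1; apply/negP.
by rewrite -leNgt; apply: spoke_not_in_sector.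
Qed.

(** Off the spokes, the open and the closed sector meet C in the same set,
    which is thus relatively open and closed; a connected set meeting it is
    contained in it. *)
Lemma component_sub_sector y j : sector j y ->
  connected_component (C `\` S) y `<=` csector j.
Proof.
move=> jy; set D := connected_component _ y.
have DS : D `<=` C `\` S by apply: connected_component_sub.
have eqD : D `&` sector j = D `&` csector j.
  apply/seteqP; split => z [Dz]; first by move/open_sector_closed.
  by have [Cz nSz] := DS z Dz; move=> /(sector_interior_off_spokes Cz nSz).
have [Dy|nDy] := pselect (D y); last first.
  move=> z [B [By BC _] _]; case: nDy.
  exact: connected_component_refl (BC _ By).
have := @component_connected _ (C `\` S) y (D `&` sector j).
rewrite -/D => <-; first by move=> z [_ /open_sector_closed].
- by exists y.
- by exists (sector j) => //; exact: open_open_sector.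
- by exists (csector j) => //; exact: closed_closed_sector.
Qed.

Lemma sector_sub_component w y j : (j < k)%N ->
  C w -> sector j w -> C y -> sector j y ->
  connected_component (C `\` S) w y.
Proof.
move=> jk Cw jw Cy jy; exists (segment w y); last first.
  by exists 1; rewrite /= ?in_itv /= ?ler01 ?lexx // subrr scale0r add0r scale1r.
split; last exact: connected_segment.
  by exists 0; rewrite /= ?in_itv /= ?ler01 ?lexx // subr0 scale0r addr0 scale1r.
move=> z [t /=]; rewrite in_itv /= => /andP [t0 t1] <-.
split; first exact: convex_set_segment.
apply: (@sector_disjoint_spokes _ j) => //.
have [->|tn] := eqVneq t 0; first by rewrite subr0 scale0r addr0 scale1r.
apply: sector_segment => //; first exact: open_sector_closed.
by rewrite lt_neqAle eq_sym tn.
Qed.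

(** The points of the segment from w to u, other than u, lie in the open sector
    and in C, hence in the component of w. *)
Lemma component_closure w u j : (j < k)%N ->
  C w -> sector j w -> C u -> csector j u ->
  closure (connected_component (C `\` S) w) u.
Proof.
move=> jk Cw jw Cu ju; apply/closure_sqP => e e0.
set N := dot (w - u) (w - u).
have N0 : 0 <= N by apply: sq_ge0.
have eN : 0 < e + N by rewrite ltr_wpDr.
(* As t <= 1, the squared distance t^2 N is at most t N < e. *)
pose t := e / (e + N).
have t0 : 0 < t by rewrite divr_gt0.
have t1 : t <= 1 by rewrite ler_pdivrMr // mul1r lerDl.
exists ((1 - t) *: u + t *: w).
  apply: (sector_sub_component jk) => //.
    by apply: convex_set_segment => //; apply: ltW.
  exact: sector_segment.
have -> : (1 - t) *: u + t *: w - u = t *: (w - u).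
  by apply: planeP; rewrite !mxE; ring.
have -> : dot (t *: (w - u)) (t *: (w - u)) = t * (t * N).
  by rewrite /N /dot !mxE; ring.
apply: (@le_lt_trans _ _ (t * N)); first by rewrite ler_piMl // mulr_ge0 // ltW.
by rewrite /t mulrAC ltr_pdivrMr // ltr_pM2l // ltrDr.
Qed.

Lemma sector_inhabited j : exists2 w, C w & sector j w.
Proof.
(* The midpoint of the ends of the two spokes. *)
exists ((1 - 2^-1) *: (p + d j) + 2^-1 *: (p + d j.+1)).
  apply: convex_set_segment; try exact: spoke_end; [by []|by rewrite invr_ge0|].
  by rewrite invf_le1 // ler1n.
have h := spoke_dir_cross j.
split.
  have -> : cross (d j) ((1 - 2^-1) *: (p + d j) + 2^-1 *: (p + d j.+1) - p) =
    2^-1 * cross (d j) (d j.+1) by rewrite /cross !mxE; field.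
  by rewrite mulr_gt0 ?invr_gt0.
have -> : cross ((1 - 2^-1) *: (p + d j) + 2^-1 *: (p + d j.+1) - p) (d j.+1) =
    2^-1 * cross (d j) (d j.+1) by rewrite /cross !mxE; field.
by rewrite mulr_gt0 ?invr_gt0.
Qed.

Lemma piece_sub_sector A : pieces C S A ->
  A !=set0 /\ exists j, A `<=` C `&` csector j.
Proof.
move=> [y [Cy nSy] <-]; split.
  by exists y; apply: subset_closure; apply: connected_component_refl.
have [j jk jy] := sector_cover y; exists j.
have cl : closed (C `&` csector j) by exact: closedI (@closed_closed_sector _ _ _ _).
rewrite [X in _ `<=` X]((closure_id _).1 cl).
apply: closureS => z Dz; split; first by have [] := connected_component_sub Dz.
exact: component_sub_sector (sector_interior_off_spokes Cy nSy jy) _ Dz.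
Qed.

(** Makes the suprema below suprema of bounded sets, as sup is 0 on an unbounded
    set. *)
Lemma eucl_dist_bounded u v : C u -> C v -> eucl_dist u v <= 2 * circumradius C.
Proof.
have [R0 Rle _] := circumradius_center cC Cp (ltnW k3) sC.
move=> /Rle hu /Rle hv; rewrite eucl_dist_le ?mulr_ge0 //.
have -> : v - u = (v - p) - (u - p) by rewrite opprB addrA subrK.
have := sq_ge0 ((v - p) + (u - p)).
move: (v - p) (u - p) hu hv => a b; rewrite /dot !mxE; nra.
Qed.

Lemma max_relative_diameter_le r :
  (forall j u v, C u -> C v -> csector j u -> csector j v -> eucl_dist u v <= r) ->
  max_relative_diameter (pieces C S) <= r.
Proof.
move=> h; apply: ge_sup => [|_ [A PA <-]].
  have [w Cw jw] := sector_inhabited 0.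
  exists (diameter (closure (connected_component (C `\` S) w))).
  exists (closure (connected_component (C `\` S) w)) => //.
  by exists w => //; split => //; apply: (sector_disjoint_spokes k0).
have [A0 [j Aj]] := piece_sub_sector PA.
by apply: diameter_le => // u v /Aj [Cu ju] /Aj [Cv jv]; apply: (h j).
Qed.

Lemma max_relative_diameter_ge j u v : (j < k)%N ->
  C u -> C v -> csector j u -> csector j v ->
  eucl_dist u v <= max_relative_diameter (pieces C S).
Proof.
move=> jk Cu Cv ju jv.
have bd A : pieces C S A -> forall u v, A u -> A v ->
    eucl_dist u v <= 2 * circumradius C.
  move=> /piece_sub_sector [_ [i Ai]] u' v' /Ai [Cu' _] /Ai [Cv' _].
  exact: eucl_dist_bounded.
have [w Cw jw] := sector_inhabited j.
set A := closure (connected_component (C `\` S) w).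
have PA : pieces C S A.
  by exists w => //; split => //; apply: (sector_disjoint_spokes jk).
apply: (@le_trans _ _ (diameter A)).
  by apply: (diameter_ge (bd _ PA)); apply: (component_closure jk).
apply: ub_le_sup; last by exists A.
exists (2 * circumradius C) => _ [B PB <-].
by apply: diameter_le; [case: (piece_sub_sector PB)|exact: bd].
Qed.

(** A sector containing a point at distance R from p also contains p. *)
Lemma circumradius_le_max_relative_diameter :
  circumradius C <= max_relative_diameter (pieces C S).
Proof.
have [R0 _ [q Cq qR]] := circumradius_center cC Cp (ltnW k3) sC.
have [j jk jq] := sector_cover q.
apply: le_trans (max_relative_diameter_ge jk Cp Cq _ jq); last first.
  by split; rewrite subrr /cross !mxE ?mul0r ?mulr0 subrr.
by rewrite eucl_distE qR sqrtr_sqr ger0_norm.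
Qed.

End StandardPartition.

(** * Partitions with at least six pieces, and with three pieces *)

Section ExtremeCases.
Variables (R : realType) (C : set (plane R)) (p x : plane R).
Implicit Types (u v w y : plane R) (s t a e : R) (k m : nat).
Hypotheses (cC : compact C) (vC : convex_set C) (pI : C° p) (xF : frontier C x).

Lemma max_relative_diameter_ge6 k : (6 <= k)%N ->
  turn_stable C p (2 * pi / k%:R) ->
  max_relative_diameter (pieces C (spokes p x k)) = circumradius C.
Proof.
move=> k6 sC; have k3 : (3 <= k)%N by apply: leq_trans k6.
have Cp : C p by apply: interior_subset pI.
have [R0 Rle _] := circumradius_center cC Cp (ltnW k3) sC.
have pi0 := pi_gt0 R.
have kp : 0 < k%:R :> R by rewrite ltr0n; apply: leq_trans k6.
apply/eqP; rewrite eq_le circumradius_le_max_relative_diameter // andbT.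
apply: max_relative_diameter_le => // j u v Cu Cv ju jv.
rewrite eucl_dist_le //.
have -> : v - u = (v - p) - (u - p) by rewrite opprB addrA subrK.
apply: (@narrow_sector _ (spoke_dir p x k j) (spoke_dir p x k j.+1)).
- exact: spoke_dir_cross k3 pI xF j.
- by rewrite !sq_turn.
- rewrite sq_turn dot_turn mulrA ler_peMl ?sq_ge0 //.
  have -> : 2 * pi * j.+1%:R / k%:R - 2 * pi * j%:R / k%:R = 2 * pi / k%:R :> R.
    by rewrite -natr1; field; rewrite gt_eqF.
  have : cos (pi / 3%:R) <= cos (2 * pi / k%:R : R).
    rewrite leNgt ltr_cos; last 2 first.
    + by rewrite in_itv /=; lra.
    + rewrite in_itv /= divr_ge0 ?mulr_ge0 ?pi_ge0 ?(ltW kp) //=.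
      rewrite ler_pdivrMr // mulrC ler_pM2l // (ler_nat R 2).
      by apply: leq_trans k6.
    rewrite -leNgt ler_pdivrMr // mulrAC ler_pdivlMr //.
    have : 6%:R <= k%:R :> R by rewrite ler_nat.
    by nra.
  by rewrite cos_pi3; lra.
- by move: jv; rewrite /closed_sector /= subr0.
- by move: ju; rewrite /closed_sector /= subr0.
- exact: Rle.
- exact: Rle.
Qed.

(** The witnesses are the first and the last of the m points that the orbit of
    a farthest point q has in a sector of angle 2 pi / 3. After rotating q
    into the first of the 3m sectors, they are obtained from it by the angles 0
    and t = (m - 1) be, where be = 2 pi / (3m); m >= 3 is what makes t exceed
    pi / 3. *)
Lemma max_relative_diameter_3 m : (3 <= m)%N ->
  turn_stable C p (2 * pi / (3 * m)%:R) ->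
  circumradius C < max_relative_diameter (pieces C (spokes p x 3)).
Proof.
move=> m3 sK.
have Cp : C p by apply: interior_subset pI.
have K3 : (3 <= 3 * m)%N by rewrite leq_pmulr //; apply: leq_trans m3.
have [R0 Rle [q Cq qR]] := circumradius_center cC Cp (ltnW K3) sK.
have m0 : 0 < m%:R :> R by rewrite ltr0n; apply: leq_trans m3.
have mn : m%:R != 0 :> R by rewrite gt_eqF.
pose be : R := 2 * pi / (3 * m)%:R.
have bm : be * m%:R = 2 * pi / 3%:R by rewrite /be natrM; field.
have s3 : turn_stable C p (2 * pi / 3%:R).
  by rewrite -bm; apply: turn_stable_mul.
have [j _ jq] := sector_cover p x K3 q.
pose q' := p + turn (- be * j%:R) (q - p).
have q'p : q' - p = turn (- be * j%:R) (q - p) by rewrite addrAC subrr add0r.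
have Cq' : C q'.
  by apply: (turn_stable_mul _ (turn_stableN _ sK)) => //; apply: leq_trans K3.
have D0 : 0 < dot (x - p) (x - p) by apply: frontier_neq_center pI xF.
have [a [b [a0 b0 qab]]] := closed_sector_cone (spoke_dir_cross K3 pI xF j) jq.
have q'ab : q' - p = a *: (x - p) + b *: turn be (x - p).
  rewrite q'p qab (turnD (- be * j%:R)) !turnZ !turn_add.
  congr (_ *: _ + _ *: turn _ _).
    by rewrite -[RHS]turn0; congr turn; rewrite /be; ring.
  by rewrite -natr1 /be; ring.
pose t := be * (m%:R - 1).
pose q2 := p + turn t (q' - p).
have q2p : q2 - p = turn t (q' - p) by rewrite addrAC subrr add0r.
have pi0 := pi_gt0 R.
have be0 : 0 < be by rewrite divr_gt0 ?mulr_gt0 // ltr0n; apply: leq_trans K3.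
have m3' : 3%:R <= m%:R :> R by rewrite ler_nat.
have t0 : 0 <= t by rewrite mulr_ge0 ?ltW // subr_gt0; lra.
have tb : t + be = be * m%:R by rewrite /t; ring.
have bmpi : be * m%:R <= pi by rewrite bm; lra.
have stay s : 0 <= s -> s <= t ->
    closed_sector p (spoke_dir p x 3 0) (spoke_dir p x 3 1) (p + turn s (q' - p)).
  move=> s0 st.
  rewrite /closed_sector /spoke_dir /= mulr0 mul0r turn0 mulr1 -bm.
  rewrite addrAC subrr add0r q'ab (turnD s) !turnZ turn_add.
  have crD u v w : cross u (a *: v + b *: w) = a * cross u v + b * cross u w.
    by rewrite /cross !mxE; ring.
  have crD' u v w : cross (a *: v + b *: w) u = a * cross v u + b * cross w u.
    by rewrite /cross !mxE; ring.
  have cX r : cross (x - p) (turn r (x - p)) = sin r * dot (x - p) (x - p).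
    by rewrite -{1}[x - p]turn0 cross_turn subr0.
  rewrite crD crD' !cX !cross_turn.
  split; apply: addr_ge0; apply: mulr_ge0 => //; apply: mulr_ge0; rewrite ?sq_ge0 //;
    apply: sin_ge0_pi; apply/andP; split; lra.
have Cq2 : C q2.
  have h : turn_stable C p t.
    have -> : t = be * m.-1%:R.
      by rewrite /t; case: (m) m3 => // m' _; rewrite -natr1 addrK.
    exact: turn_stable_mul.
  exact: h.
have jq' : closed_sector p (spoke_dir p x 3 0) (spoke_dir p x 3 1) q'.
  have -> : q' = p + turn 0 (q' - p) by rewrite turn0 addrC subrK.
  by apply: stay.
have jq2 := stay t t0 (lexx _).
have := max_relative_diameter_ge cC vC (leqnn 3) pI s3 xF (j := 0%N) isT
  Cq' Cq2 jq' jq2.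
apply: lt_le_trans.
have Rp : 0 < circumradius C ^+ 2.
  by apply: lt_le_trans D0 (Rle _ (frontier_mem cC xF)).
rewrite ltNge eucl_dist_le // -ltNge.
have -> : q2 - q' = turn t (q' - p) - turn 0 (q' - p).
  by rewrite -q2p turn0 opprB addrA subrK.
have -> u v : dot (u - v) (u - v) = dot u u + dot v v - 2 * dot v u.
  by rewrite /dot !mxE; ring.
rewrite !sq_turn dot_turn subr0 q'p sq_turn qR.
have : cos t < cos (pi / 3%:R).
  rewrite ltr_cos ?in_itv /=; last 2 first.
  - by apply/andP; split; lra.
  - by apply/andP; split; lra.
  suff : be * m%:R < 2 * t by rewrite bm; lra.
  by rewrite /t; nra.
rewrite cos_pi3; move: (circumradius C ^+ 2) Rp (cos t) => r r0 c hc.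
have : 0 < r * (1 - 2 * c) by rewrite mulr_gt0 // subr_gt0; lra.
by lra.
Qed.

End ExtremeCases.

(** * Degrees of symmetry *)

Section Degrees.
Variable R : realType.
Implicit Types (C : set (plane R)) (p : plane R) (k l d : nat).

(** By Bezout, 2 pi / lcm k l is an integer combination of 2 pi / k and
    2 pi / l. *)
Lemma turn_stable_lcm C p k l : (0 < k)%N -> (0 < l)%N ->
  turn_stable C p (2 * pi / k%:R) -> turn_stable C p (2 * pi / l%:R) ->
  turn_stable C p (2 * pi / (lcmn k l)%:R).
Proof.
move=> k0 l0 sk sl; have [u v uv _] := egcdnP l k0.
have -> : 2 * pi / (lcmn k l)%:R =
    2 * pi / l%:R * u%:R + - (2 * pi / k%:R) * v%:R :> R.
  have kl : (lcmn k l)%:R * (gcdn k l)%:R = k%:R * l%:R :> R.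
    by rewrite -!natrM muln_lcm_gcd.
  have uv' : u%:R * k%:R = v%:R * l%:R + (gcdn k l)%:R :> R by rewrite -!natrM uv natrD.
  have kn : k%:R != 0 :> R by rewrite pnatr_eq0 -lt0n.
  have ln : l%:R != 0 :> R by rewrite pnatr_eq0 -lt0n.
  have mn : (lcmn k l)%:R != 0 :> R by rewrite pnatr_eq0 -lt0n lcmn_gt0 k0.
  apply: (mulIf mn); rewrite divfK //.
  apply: (mulIf (mulf_neq0 kn ln)).
  transitivity (2 * pi * (lcmn k l)%:R * (u%:R * k%:R - v%:R * l%:R) : R).
    by rewrite uv' addrAC subrr add0r -kl; ring.
  by field; apply/andP.
apply: turn_stableD; first exact: turn_stable_mul.
by apply: turn_stable_mul; apply: turn_stableN.
Qed.

Lemma turn_stable_dvd C p k d : (0 < k)%N -> (d %| k)%N ->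
  turn_stable C p (2 * pi / k%:R) -> turn_stable C p (2 * pi / d%:R).
Proof.
move=> k0 /dvdnP [m km] /(@turn_stable_mul _ _ _ _ m).
have -> // : 2 * pi / k%:R * m%:R = 2 * pi / d%:R :> R.
have kn : k%:R != 0 :> R by rewrite pnatr_eq0 -lt0n.
move: kn; rewrite km natrM mulf_eq0 negb_or => /andP [mn dn].
by field; apply/andP.
Qed.

Lemma mem_degrees k d : (0 < k)%N -> (d \in degrees k) = (1 < d)%N && (d %| k)%N.
Proof. by move=> k0; rewrite /degrees mem_filter -dvdn_divisors. Qed.

(** A degree l shares its center with the maximal degree k, so lcm k l is a
    degree too; by maximality it is k. *)
Lemma rotationally_symmetricP C k : compact C -> is_maximal_degree C k ->
  forall l, rotationally_symmetric C l <-> l \in degrees k.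
Proof.
move=> cC [[k2 [p pk]] kmax] l; have k0 : (0 < k)%N by apply: leq_trans k2.
rewrite mem_degrees //; have [Cp sk] := (is_symmetry_centerP C p k0).1 pk.
split=> [[l2 [p' pl]]|/andP [l2 lk]]; last first.
  split => //; exists p; apply/is_symmetry_centerP; first exact: ltnW.
  by split => //; exact: turn_stable_dvd sk.
have l0 : (0 < l)%N by apply: leq_trans l2.
have [Cp' sl] := (is_symmetry_centerP C p' l0).1 pl.
rewrite l2 /=.
have pp := symmetry_center_unique cC Cp k2 sk Cp' l2 sl; subst p'.
have m0 : (0 < lcmn k l)%N by rewrite lcmn_gt0 k0.
have km : (k %| lcmn k l)%N by apply: dvdn_lcml.
suff mk : (lcmn k l <= k)%N.
  have -> : k = lcmn k l by apply/eqP; rewrite eqn_leq mk dvdn_leq.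
  exact: dvdn_lcmr.
apply: kmax; split; first by apply: leq_trans k2 (dvdn_leq m0 km).
by exists p; apply/is_symmetry_centerP => //; split => //; exact: turn_stable_lcm.
Qed.

Lemma standard_partition_data C k P : convex_body C ->
  standard_partition C k P -> exists p x,
  [/\ C° p, turn_stable C p (2 * pi / k%:R), frontier C x
    & P = pieces C (spokes p x k)].
Proof.
move=> [cC vC iC] [k2 [p [x [pk xF _ PE]]]]; exists p, x.
have [Cp sk] := (is_symmetry_centerP C p (ltnW k2)).1 pk.
by split => //; exact: center_interior sk.
Qed.

End Degrees.

Theorem lemma3p3 (R : realType) (C : set (plane R)) (chi kC : nat)
    (P : nat -> set (set (plane R))) :
  convex_body C ->
  multi_rotationally_symmetric C ->
  is_minimal_degree C chi ->
  (3 <= chi)%N ->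
  is_maximal_degree C kC ->
  (forall k : nat, k \in degrees kC -> standard_partition C k (P k)) ->
  (forall i : nat, (i.+1 < size (degrees kC))%N ->
     max_relative_diameter (P (nth 0%N (degrees kC) i)) =
     max_relative_diameter (P (nth 0%N (degrees kC) i.+1)))
  <-> max_relative_diameter (P chi) = circumradius C.
Proof.
move=> bC mC [chiS chimin] chi3 kCmax HP.
have [cC vC iC] := bC; have [kS kmax] := kCmax.
have degP l := rotationally_symmetricP cC kCmax l.
have chiD : chi \in degrees kC by apply/degP.
have kD : kC \in degrees kC by apply/degP.
have chi_k : (chi < kC)%N.
  have [k [l [kl kd ld]]] := mC; rewrite ltnNge; apply/negP => kchi.
  have e m : rotationally_symmetric C m -> m = chi.
    by move=> ms; apply/eqP; rewrite eqn_leq chimin // andbT (leq_trans (kmax _ ms)).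
  by move: kl; rewrite (e _ kd) (e _ ld) eqxx.
have k0 : (0 < kC)%N by apply: leq_trans chi_k.
have degE d : (d \in degrees kC) = (1 < d)%N && (d %| kC)%N by apply: mem_degrees.
have k6 : (6 <= kC)%N.
  move: chiD; rewrite degE => /andP [_ /dvdnP [m kE]].
  by move: chi_k; rewrite kE; case: m {kE} => [|[|m]]; lia.
have big d : d \in degrees kC -> (6 <= d)%N ->
    max_relative_diameter (P d) = circumradius C.
  move=> dD d6; have [p [x [pI sd xF ->]]] := standard_partition_data bC (HP d dD).
  exact: max_relative_diameter_ge6.
split=> [Heq|chiR i iS].
  have all_eq i : (i < size (degrees kC))%N ->
      max_relative_diameter (P (nth 0%N (degrees kC) i)) =
      max_relative_diameter (P (nth 0%N (degrees kC) 0)).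
    by elim: i => [//|i IH] iS; rewrite -Heq // IH // ltnW.
  have mem_eq d : d \in degrees kC -> max_relative_diameter (P d) =
      max_relative_diameter (P (nth 0%N (degrees kC) 0)).
    by move=> dD; rewrite -(all_eq (index d (degrees kC))) ?index_mem // nth_index.
  by rewrite mem_eq // -(mem_eq kC) // big.
suff allR d : d \in degrees kC -> max_relative_diameter (P d) = circumradius C.
  by rewrite !allR // mem_nth // ltnW.
move=> dD; have [|d6] := leqP 6 d; first exact: big.
have chid : (chi <= d)%N by apply: chimin; apply/degP.
have [<- //|ned] := eqVneq chi d.
have n2 : ~~ (2 %| kC)%N.
  apply/negP => k2; have /degP /chimin : 2%N \in degrees kC by rewrite degE.
  by rewrite leqNgt chi3.
have n4 : ~~ (4 %| kC)%N by apply: contra n2; apply: dvdn_trans.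
move: (chiD) (dD); rewrite !degE => /andP [_ chik] /andP [_ dk].
have chiE : chi = 3%N.
  have : (chi < 5)%N by move: ned => /eqP; lia.
  by move: chi3 chik; case: (chi) => [|[|[|[|[|]]]]] // _ h; rewrite h in n4.
subst chi; have dE : d = 5%N.
  move: chid ned d6 dk; case: (d) => [|[|[|[|[|[|[|]]]]]]] // _ _ _ h.
  by rewrite h in n4.
subst d.
have k15 : (15 %| kC)%N by rewrite (@Gauss_dvd 3 5) // chik dk.
case/dvdnP: (chik) => m kE.
have m3 : (3 <= m)%N.
  by have := dvdn_leq k0 k15; rewrite kE; lia.
have [p [x [pI s3 xF PE]]] := standard_partition_data bC (HP 3%N chiD).
have [p' [x' [p'I sk x'F _]]] := standard_partition_data bC (HP kC kD).
have pp : p = p'.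
  apply: (symmetry_center_unique cC (interior_subset pI) _ s3
    (interior_subset p'I) _ sk) => //.
  by apply: leq_trans k6.
subst p'.
move: sk; rewrite kE mulnC => sk.
have := max_relative_diameter_3 cC vC pI xF m3 sk.
by rewrite -PE chiR ltxx.
Qed.
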